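(* Let $\Gamma$ be a group that is nilpotent of class $\le n$, let $S\subseteq\Gamma\setminus\{\mathbb{I}\}$ be a generating set, $G:=\mathrm{Cay}(\Gamma,S)$, and let $r\ge\max\{2^{n+2},10\}$ be an integer. Let $h\in S$ be such that $\{\mathbb{I},h\}$ is an $r$-local $2$-separator of $G$, and suppose that $G$ has no $r$-local cutvertex. If $h$ is an involution, then the subgroup of $\Gamma$ generated by $h$ is normal.
   Context: Generating sets are closed under inverses; $\mathrm{Cay}(\Gamma,S)$ is the simple graph on $\Gamma$ with edges $\{g,gs\}$. $a\equiv b$ means $a=b$ or $a=b^{-1}$; $\Gamma$ is nilpotent of class $\le n$ if $[g,h]_n=\mathbb{I}$ for all $g\not\equiv h$, where $[g,h]_1=gh^{-1}g^{-1}h$ and $[g,h]_n$ is the reduced form of $g[g,h]_{n-1}^{-1}g^{-1}[g,h]_{n-1}$. Ball $B_r(v)$: subgraph of all vertices and edges on closed walks of length $\le r$ through $v$; $v$ is an $r$-local cutvertex if $B_r(v)-v$ is disconnected. For $X=\{v_0,v_1\}$, $N(X)$ is the set of vertices outside $X$ adjacent to $X$; the connectivity graph $C_r(v_0,v_1)$ has vertex set $N(X)$, $a,b$ adjacent if for some $i$ they lie in the same component of $B_r(v_i)-v_0-v_1$; $X$ is an $r$-local $2$-separator if $C_r(v_0,v_1)$ is disconnected and $d_G(v_0,v_1)\le r/2$. *)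

(* Defs.v *)
From Stdlib Require Import List Arith Relations.
Import ListNotations.

Record group := Group {
  carrier :> Type;
  gmul : carrier -> carrier -> carrier;
  ginv : carrier -> carrier;
  gone : carrier;
  gmulA : forall x y z, gmul x (gmul y z) = gmul (gmul x y) z;
  gmul1l : forall x, gmul gone x = x;
  gmulVl : forall x, gmul (ginv x) x = gone }.

Arguments gmul {g}.
Arguments ginv {g}.
Arguments gone {g}.

Inductive generated {Gm : group} (A : Gm -> Prop) : Gm -> Prop :=
| gen_in : forall x, A x -> generated A x
| gen_one : generated A gone
| gen_mul : forall x y, generated A x -> generated A y -> generated A (gmul x y)
| gen_inv : forall x, generated A x -> generated A (ginv x).

Definition normal {Gm : group} (H : Gm -> Prop) : Prop :=
  forall g x, H x -> H (gmul (gmul g x) (ginv g)).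

Definition gequiv {Gm : group} (a b : Gm) : Prop := a = b \/ a = ginv b.

(* comm_iter g h k = [g,h]_{k+1}:
   [g,h]_1 = g h^{-1} g^{-1} h,  [g,h]_m = g [g,h]_{m-1}^{-1} g^{-1} [g,h]_{m-1} *)
Fixpoint comm_iter {Gm : group} (g h : Gm) (k : nat) : Gm :=
  match k with
  | 0 => gmul (gmul (gmul g (ginv h)) (ginv g)) h
  | S k' => let c := comm_iter g h k' in
            gmul (gmul (gmul g (ginv c)) (ginv g)) c
  end.

(* nilpotent of class <= n (n >= 1): [g,h]_n = 1 for all g ≢ h *)
Definition nilpotent_le (Gm : group) (n : nat) : Prop :=
  forall g h : Gm, ~ gequiv g h -> comm_iter g h (n - 1) = gone.

Definition generating_set {Gm : group} (S : Gm -> Prop) : Prop :=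
  (forall s, S s -> S (ginv s)) /\ (forall g, generated S g).

Definition involution {Gm : group} (h : Gm) : Prop :=
  gmul h h = gone /\ h <> gone.

Definition cay_adj {Gm : group} (S : Gm -> Prop) (x y : Gm) : Prop :=
  exists s, S s /\ y = gmul x s.

Section Graphs.
Variable T : Type.
Variable adj : T -> T -> Prop.

Fixpoint is_walk (l : list T) : Prop :=
  match l with
  | x :: ((y :: _) as t) => adj x y /\ is_walk t
  | _ => True
  end.

(* a closed walk of length (length l - 1) <= r through v *)
Definition short_closed_walk_through (r : nat) (v : T) (l : list T) : Prop :=
  is_walk l /\ l <> [] /\ hd v l = last l v /\ length l <= S r /\ In v l.

Definition ball_v (r : nat) (v x : T) : Prop :=
  exists l, short_closed_walk_through r v l /\ In x l.

Definition ball_e (r : nat) (v x y : T) : Prop :=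
  exists l, short_closed_walk_through r v l /\
    exists l1 l2, l = l1 ++ x :: y :: l2 \/ l = l1 ++ y :: x :: l2.

Definition ballm_v (r : nat) (v : T) (Z : T -> Prop) (x : T) : Prop :=
  ball_v r v x /\ ~ Z x.

Definition ballm_e (r : nat) (v : T) (Z : T -> Prop) (x y : T) : Prop :=
  ball_e r v x y /\ ~ Z x /\ ~ Z y.

Definition same_comp (r : nat) (v : T) (Z : T -> Prop) (a b : T) : Prop :=
  ballm_v r v Z a /\ ballm_v r v Z b /\
  clos_refl_trans T (ballm_e r v Z) a b.

Definition local_cutvertex (r : nat) (v : T) : Prop :=
  exists a b, ballm_v r v (fun z => z = v) a /\ ballm_v r v (fun z => z = v) b /\
    ~ clos_refl_trans T (ballm_e r v (fun z => z = v)) a b.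

Definition pairset (v0 v1 : T) (z : T) : Prop := z = v0 \/ z = v1.

Definition nbhd (v0 v1 : T) (a : T) : Prop :=
  ~ pairset v0 v1 a /\ exists x, pairset v0 v1 x /\ adj x a.

Definition conn_edge (r : nat) (v0 v1 : T) (a b : T) : Prop :=
  nbhd v0 v1 a /\ nbhd v0 v1 b /\
  exists vi, pairset v0 v1 vi /\ same_comp r vi (pairset v0 v1) a b.

Definition dist_le (x y : T) (d : nat) : Prop :=
  exists l, is_walk l /\ l <> [] /\ hd x l = x /\ hd y (rev l) = y
            /\ length l <= S d.

Definition local_2_separator (r : nat) (v0 v1 : T) : Prop :=
  (exists a b, nbhd v0 v1 a /\ nbhd v0 v1 b /\
     ~ clos_refl_trans T (conn_edge r v0 v1) a b)
  /\ exists d, dist_le v0 v1 d /\ 2 * d <= r.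

End Graphs.

(* Main.v *)
Require Import Defs.
From Stdlib Require Import List Arith Relations Lia Classical.
Import ListNotations.

(** Write [X = {1, h}] and call two neighbours of [X] similar if they lie in the same
    component of the connectivity graph.  A closed walk of length at most [r] can be cut at
    the cosets [gX] as at cutvertices: a subwalk that returns to a coset and is shortest with
    this property closes up, by an [h]-edge if needed, to a closed walk that visits each of
    its cosets once.  Such a walk is a short detour around each coset it meets, so it enters
    and leaves that coset through similar neighbours.

    Since [h] is an involution, nilpotency says that the product of two conjugates of [h] has
    order dividing [2^(n-1)], so the powers of such products are closed words of length at
    most [r] if the conjugating elements are short.  If consecutive letters are not similar,
    a return cannot contain both, which leaves few possible returns.  With [h (s h s^-1)]
    this shows that [s] and [h s] are similar for every generator [s <> h].  If [t] is a
    generator not commuting with [h], then [(t^-1 h t) (t h t^-1)] shows that [t] and [t^-1]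
    are similar, and [(t^-1 h t) (u t^-1 h t u^-1)] that every generator [u <> h] is similar
    to [t].  The connectivity graph would then be connected; so [h] is central. *)

(** * Contiguous subwords *)

Section Infix.
Variable A : Type.
Implicit Types u v w l : list A.

Definition infix u w : Prop := exists a e, w = a ++ u ++ e.

Lemma infix_refl w : infix w w.
Proof. exists [], []. now rewrite app_nil_r. Qed.

Lemma infix_trans v u w : infix u v -> infix v w -> infix u w.
Proof.
  intros [a [e ->]] [a' [e' ->]]. exists (a' ++ a), (e ++ e').
  now rewrite <- !app_assoc.
Qed.

Lemma infix_length u w : infix u w -> length u <= length w.
Proof. intros [a [e ->]]. rewrite !length_app. lia. Qed.

Lemma infix_length_eq u w : infix u w -> length w <= length u -> u = w.
Proof.
  intros [a [e ->]] H. rewrite !length_app in H.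
  assert (a = []) as -> by (apply length_zero_iff_nil; lia).
  assert (e = []) as -> by (apply length_zero_iff_nil; lia).
  now rewrite app_nil_r.
Qed.

Lemma Forall_infix (P : A -> Prop) u w : infix u w -> Forall P w -> Forall P u.
Proof. intros [a [e ->]]. rewrite !Forall_app. tauto. Qed.

Lemma infix_split u l x y l' :
  infix u (l ++ x :: y :: l') ->
  infix u (l ++ [x]) \/ infix u (y :: l') \/ infix [x; y] u.
Proof.
  intros [a [e E]]. replace (l ++ x :: y :: l') with ((l ++ [x]) ++ y :: l') in E
    by now rewrite <- app_assoc.
  apply app_eq_app in E. destruct E as [b [[E1 E2]|[E1 E2]]].
  - apply app_eq_app in E2. destruct E2 as [f [[-> E3]|[-> E3]]].
    + destruct f as [|z f]; [left; exists a, []; now rewrite !app_nil_r in *|].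
      destruct b as [|z' b _] using rev_ind.
      * right; left. exists [], e. exact E3.
      * rewrite app_assoc in E1. apply app_inj_tail in E1 as [_ <-].
        injection E3 as <- _. right; right. exists b, f. now rewrite <- app_assoc.
    + left. now exists a, f.
  - right; left. now exists b, e.
Qed.

Lemma infix_concat_repeat u x l y N :
  infix u (concat (repeat (y :: l ++ [x]) N)) ->
  infix u (y :: l ++ [x]) \/ infix [x; y] u.
Proof.
  induction N as [|[|N] IH]; intros H.
  - left. replace u with (@nil A); [now exists [], (y :: l ++ [x])|].
    symmetry. apply length_zero_iff_nil. apply infix_length in H. simpl in H. lia.
  - left. simpl in H. now rewrite app_nil_r in H.
  - change (infix u ((y :: l ++ [x]) ++ concat (repeat (y :: l ++ [x]) (S N)))) in H.
    rewrite app_comm_cons, <- app_assoc in H. apply infix_split in H.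
    destruct H as [H|[H|H]]; auto.
Qed.

Lemma length_concat_repeat l N : length (concat (repeat l N)) = N * length l.
Proof. induction N as [|N IH]; simpl; [easy|]. now rewrite length_app, IH. Qed.

End Infix.

Arguments infix {A}.

(** * Groups *)

Section Groups.
Variable Gm : group.
Implicit Types g x y z : Gm.

Lemma gmulKl x y : gmul (ginv x) (gmul x y) = y.
Proof. now rewrite gmulA, gmulVl, gmul1l. Qed.

Lemma gmulVr x : gmul x (ginv x) = gone.
Proof.
  rewrite <- (gmulKl (ginv x) (gmul x (ginv x))), (gmulKl x).
  apply gmulVl.
Qed.

Lemma gmul1r x : gmul x gone = x.
Proof. now rewrite <- (gmulVl _ x), gmulA, gmulVr, gmul1l. Qed.

Lemma gmulKr x y : gmul x (gmul (ginv x) y) = y.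
Proof. now rewrite gmulA, gmulVr, gmul1l. Qed.

Lemma gmul_injl x y z : gmul x y = gmul x z -> y = z.
Proof. intros H. now rewrite <- (gmulKl x y), H, gmulKl. Qed.

Lemma ginv_unique x y : gmul x y = gone -> y = ginv x.
Proof. intros H. apply (gmul_injl x). now rewrite H, gmulVr. Qed.

Lemma ginvK x : ginv (ginv x) = x.
Proof. symmetry. apply ginv_unique, gmulVl. Qed.

Lemma ginvM x y : ginv (gmul x y) = gmul (ginv y) (ginv x).
Proof.
  symmetry. apply ginv_unique. now rewrite <- gmulA, gmulKr, gmulVr.
Qed.

Lemma ginv1 : ginv (@gone Gm) = gone.
Proof. symmetry. apply ginv_unique, gmul1l. Qed.

End Groups.

#[local] Hint Rewrite <- gmulA : grp.
#[local] Hint Rewrite gmul1l gmul1r gmulVl gmulVr gmulKl gmulKr ginvM ginvK ginv1 : grp.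

Section GroupWords.
Context {Gm : group}.
Implicit Types g x y z : Gm.

Definition commutes x y : Prop := gmul x y = gmul y x.

Lemma commutes_mulr z x y : commutes z x -> commutes z y -> commutes z (gmul x y).
Proof. unfold commutes. intros Hx Hy. now rewrite gmulA, Hx, <- gmulA, Hy, gmulA. Qed.

Lemma commutes_invr z x : commutes z x -> commutes z (ginv x).
Proof.
  unfold commutes. intros H. apply (gmul_injl _ x).
  rewrite gmulA, <- H. now autorewrite with grp.
Qed.

Lemma generated_commutes (A : Gm -> Prop) z x :
  (forall y, A y -> commutes z y) -> generated A x -> commutes z x.
Proof.
  intros HA H. induction H; auto using commutes_mulr, commutes_invr.
  unfold commutes. now rewrite gmul1l, gmul1r.
Qed.

Definition gconj g x : Gm := gmul (gmul g x) (ginv g).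

Lemma gconj_commutes g x : gconj g x = x <-> commutes x g.
Proof.
  unfold gconj, commutes. split; intros H.
  - rewrite <- H at 1. now autorewrite with grp.
  - rewrite <- H. now autorewrite with grp.
Qed.

Lemma gconj_eq1 g x : gconj g x = gone -> x = gone.
Proof.
  unfold gconj. intros H. apply (gmul_injl _ g).
  apply ginv_unique in H. rewrite gmul1r, <- (ginvK _ (gmul g x)), <- H.
  now autorewrite with grp.
Qed.

Fixpoint gpow x (k : nat) : Gm :=
  match k with 0 => gone | S k' => gmul x (gpow x k') end.

Lemma gpowD x a b : gpow x (a + b) = gmul (gpow x a) (gpow x b).
Proof.
  induction a as [|a IH]; simpl; [now rewrite gmul1l|]. now rewrite IH, gmulA.
Qed.

Lemma gpow1n k : gpow gone k = gone.
Proof. induction k as [|k IH]; simpl; [easy|]. now rewrite gmul1l. Qed.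

Lemma gpow_gconj g x k : gpow (gconj g x) k = gconj g (gpow x k).
Proof.
  unfold gconj. induction k as [|k IH]; simpl; [|rewrite IH]; now autorewrite with grp.
Qed.

Definition gprod (l : list Gm) : Gm := fold_right gmul gone l.

Lemma gprod_app l1 l2 : gprod (l1 ++ l2) = gmul (gprod l1) (gprod l2).
Proof.
  induction l1 as [|x l1 IH]; simpl; [now rewrite gmul1l|]. now rewrite IH, gmulA.
Qed.

Lemma gprod_concat_repeat l N : gprod (concat (repeat l N)) = gpow (gprod l) N.
Proof.
  induction N as [|N IH]; simpl; [easy|]. now rewrite gprod_app, IH.
Qed.

End GroupWords.

Section Involutions.
Variable Gm : group.
Variable h : Gm.
Hypothesis hh : gmul h h = gone.

Lemma ginv_involution : ginv h = h.
Proof. symmetry. now apply ginv_unique. Qed.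

Lemma gmulK_involution x : gmul h (gmul h x) = x.
Proof. now rewrite gmulA, hh, gmul1l. Qed.

Hint Rewrite hh ginv_involution gmulK_involution : grp.

(* [h] inverts every power of the commutator [[h, g]], so each further commutation with
   [h] squares it. *)
Lemma comm_iter_involution g k :
  comm_iter h g k = gpow (gmul h (gconj (ginv g) h)) (2 ^ k).
Proof.
  enough (H : comm_iter h g k = gpow (gmul h (gconj (ginv g) h)) (2 ^ k) /\
              gmul (gmul h (ginv (comm_iter h g k))) h = comm_iter h g k) by apply H.
  unfold gconj. induction k as [|k [IH Hinv]].
  - simpl. now autorewrite with grp.
  - simpl comm_iter. rewrite ginv_involution, Hinv. split.
    + rewrite IH. simpl. now rewrite gpowD, Nat.add_0_r.
    + rewrite <- Hinv at 3 4. now autorewrite with grp.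
Qed.

Lemma nilpotent_conj_mul_pow n a b :
  nilpotent_le Gm n -> gpow (gmul (gconj a h) (gconj b h)) (2 ^ (n - 1)) = gone.
Proof.
  intros Hnil. set (g := gmul (ginv b) a).
  assert (Hcomm : gpow (gmul h (gconj (ginv g) h)) (2 ^ (n - 1)) = gone).
  { destruct (classic (gequiv h g)) as [E|E].
    - assert (g = h) as ->.
      { destruct E as [<-|E]; [easy|]. now rewrite <- (ginvK _ g), <- E, ginv_involution. }
      rewrite <- (gpow1n (2 ^ (n - 1))). f_equal. unfold gconj. now autorewrite with grp.
    - rewrite <- comm_iter_involution. now apply Hnil. }
  replace (gmul (gconj a h) (gconj b h)) with (gconj a (gmul h (gconj (ginv g) h))).
  - rewrite gpow_gconj, Hcomm. unfold gconj. now autorewrite with grp.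
  - unfold gconj, g. now autorewrite with grp.
Qed.

End Involutions.

(** * Segments of short closed walks *)

Section Segments.
Variable T : Type.
Variable adj : T -> T -> Prop.

Lemma clos_refl_trans_sym (R : T -> T -> Prop) :
  (forall x y, R x y -> R y x) ->
  forall x y, clos_refl_trans T R x y -> clos_refl_trans T R y x.
Proof.
  intros HR x y H. induction H; [now apply rt_step, HR|apply rt_refl|].
  eapply rt_trans; eassumption.
Qed.

Lemma ballm_e_sym r v Z x y : ballm_e T adj r v Z x y -> ballm_e T adj r v Z y x.
Proof.
  intros [[l [Hl [l1 [l2 H]]]] [Hx Hy]]. repeat split; trivial.
  exists l. split; trivial. exists l1, l2. tauto.
Qed.

Lemma conn_edge_sym r v0 v1 x y :
  conn_edge T adj r v0 v1 x y -> conn_edge T adj r v0 v1 y x.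
Proof.
  intros [Hx [Hy [v [Hv [H1 [H2 H3]]]]]]. do 2 (split; [easy|]).
  exists v. split; [easy|]. do 2 (split; [easy|]).
  apply clos_refl_trans_sym; [apply ballm_e_sym|exact H3].
Qed.

Lemma segment_head_connected r v Z l a p b :
  short_closed_walk_through T adj r v l -> infix (a :: p) l ->
  (forall z, In z (a :: p) -> ~ Z z) -> In b (a :: p) ->
  clos_refl_trans T (ballm_e T adj r v Z) a b.
Proof.
  intros Hl. revert a. induction p as [|c p IH]; intros a Hp HZ [<-|Hb];
    try apply rt_refl; [easy|].
  destruct Hp as [l1 [l2 El]]. apply rt_trans with c.
  - apply rt_step. split; [|split; apply HZ; simpl; auto].
    exists l. split; [easy|]. exists l1, (p ++ l2). now left.
  - apply IH; auto.
    + exists (l1 ++ [a]), l2. now rewrite El, <- app_assoc.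
    + intros z Hz. apply HZ. now right.
Qed.

Lemma segment_connected r v Z l p a b :
  short_closed_walk_through T adj r v l -> infix p l ->
  (forall z, In z p -> ~ Z z) -> In a p -> In b p ->
  clos_refl_trans T (ballm_e T adj r v Z) a b.
Proof.
  intros Hl Hp HZ Ha Hb. destruct p as [|c p]; [easy|].
  apply rt_trans with c; [apply clos_refl_trans_sym; [apply ballm_e_sym|]|];
    eapply segment_head_connected; eassumption.
Qed.

Lemma segment_conn_edge r v0 v1 v l p a b :
  pairset T v0 v1 v -> short_closed_walk_through T adj r v l -> infix p l ->
  (forall z, In z p -> ~ pairset T v0 v1 z) -> In a p -> In b p ->
  nbhd T adj v0 v1 a -> nbhd T adj v0 v1 b -> conn_edge T adj r v0 v1 a b.
Proof.
  intros Hv Hl Hp HZ Ha Hb Na Nb.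
  assert (Hball : forall z, In z p -> ballm_v T adj r v (pairset T v0 v1) z).
  { intros z Hz. split; [|now apply HZ]. exists l. split; [easy|].
    destruct Hp as [l1 [l2 ->]]. rewrite !in_app_iff. auto. }
  do 2 (split; [easy|]). exists v. split; [easy|].
  do 2 (split; [auto|]). eapply segment_connected; eassumption.
Qed.

End Segments.

(** * Walks in the Cayley graph *)

Section CayleyWalks.
Context {Gm : group}.
Variable Gen : Gm -> Prop.
Implicit Types (g s : Gm) (l : list Gm).

Fixpoint steps g l : list Gm :=
  match l with [] => [] | s :: l' => gmul g s :: steps (gmul g s) l' end.

Lemma steps_app g l1 l2 :
  steps g (l1 ++ l2) = steps g l1 ++ steps (gmul g (gprod l1)) l2.
Proof.
  revert g. induction l1 as [|s l1 IH]; intros g; simpl.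
  - now rewrite gmul1r.
  - now rewrite IH, gmulA.
Qed.

Lemma length_steps g l : length (steps g l) = length l.
Proof. revert g. induction l as [|s l IH]; intros g; simpl; auto. Qed.

Lemma last_steps g l d : last (g :: steps g l) d = gmul g (gprod l).
Proof.
  revert g. induction l as [|s l IH]; intros g; [now simpl; rewrite gmul1r|].
  simpl gprod. rewrite gmulA, <- IH. easy.
Qed.

Lemma is_walk_steps g l : Forall Gen l -> is_walk Gm (cay_adj Gen) (g :: steps g l).
Proof.
  intros H. revert g. induction H as [|s l Hs _ IH]; intros g; [easy|].
  split; [now exists s|apply IH].
Qed.

Lemma in_steps g l z :
  In z (steps g l) <->
  exists l1 l2, l = l1 ++ l2 /\ l1 <> [] /\ z = gmul g (gprod l1).
Proof.
  split.
  - revert g. induction l as [|s l IH]; intros g; [easy|]. intros [<-|H].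
    + exists [s], l. simpl. now rewrite gmul1r.
    + destruct (IH _ H) as [l1 [l2 [-> [_ ->]]]]. exists (s :: l1), l2.
      simpl. now rewrite gmulA.
  - intros [l1 [l2 [-> [Hl1 ->]]]]. rewrite steps_app, in_app_iff. left.
    destruct l1 as [|s l1 _] using rev_ind; [easy|].
    rewrite steps_app, gprod_app, in_app_iff. right. left. simpl.
    now rewrite gmul1r, gmulA.
Qed.

Lemma closed_word_walk r l :
  Forall Gen l -> gprod l = gone -> length l <= r ->
  short_closed_walk_through Gm (cay_adj Gen) r gone (gone :: steps gone l).
Proof.
  intros Hgen Hone Hlen. repeat split.
  - now apply is_walk_steps.
  - easy.
  - now rewrite last_steps, Hone, gmul1r.
  - simpl. rewrite length_steps. lia.
  - now left.
Qed.

End CayleyWalks.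

Section PairWords.
Variable Gm : group.
Variable Gen : Gm -> Prop.
Variable r : nat.
Variable h : Gm.
Hypothesis Gen_inv : forall s, Gen s -> Gen (ginv s).
Hypothesis Gen_ne1 : ~ Gen gone.
Hypothesis Gen_h : Gen h.
Hypothesis hh : gmul h h = gone.

Hint Rewrite hh ginv_involution gmulK_involution using exact hh : grp.

Notation X := (pairset Gm gone h).
Notation letter := (bool * Gm)%type.
Notation sim := (clos_refl_trans Gm (conn_edge Gm (cay_adj Gen) r gone h)).

Lemma sim_sym x y : sim x y -> sim y x.
Proof. apply clos_refl_trans_sym, conn_edge_sym. Qed.

Lemma X_mul x y : X x -> X y -> X (gmul x y).
Proof. intros [-> | ->] [-> | ->]; autorewrite with grp; unfold pairset; auto. Qed.

Lemma X_inv x : X x -> X (ginv x).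
Proof. intros [-> | ->]; autorewrite with grp; unfold pairset; auto. Qed.

Lemma X_mull x y : X x -> X (gmul x y) <-> X y.
Proof.
  intros Hx. split; [|now apply X_mul].
  intros H. rewrite <- (gmulKl _ x y). auto using X_mul, X_inv.
Qed.

Lemma X_mulr x y : X y -> X (gmul x y) <-> X x.
Proof.
  intros Hy. split; [|intros Hx; now apply X_mul].
  intros H. replace x with (gmul (gmul x y) (ginv y)) by now autorewrite with grp.
  auto using X_mul, X_inv.
Qed.

Lemma gconj_in_X g : X (gconj g h) -> commutes h g.
Proof.
  intros [H|H]; [|now apply gconj_commutes].
  apply gconj_eq1 in H. destruct Gen_ne1. now rewrite <- H.
Qed.

Lemma gconj_inv_in_X g : X (gconj (ginv g) h) -> commutes h g.
Proof. intros H. rewrite <- (ginvK _ g). now apply commutes_invr, gconj_in_X. Qed.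

Lemma nbhd_gen x s : X x -> Gen s -> ~ X (gmul x s) ->
  nbhd Gm (cay_adj Gen) gone h (gmul x s).
Proof. intros Hx Hs H. split; [easy|]. exists x. split; [easy|]. now exists s. Qed.

Lemma closed_word_sim q t m s :
  Forall Gen (q ++ (t :: m) ++ [s]) -> gprod (q ++ (t :: m) ++ [s]) = gone ->
  length (q ++ (t :: m) ++ [s]) <= r -> X (gprod q) ->
  (forall l1 l2, m = l1 ++ l2 -> ~ X (gprod (q ++ t :: l1))) ->
  sim (gmul (gprod q) t) (ginv s).
Proof.
  intros Hgen Hone Hlen Hq Havoid.
  pose proof (closed_word_walk Gen r _ Hgen Hone Hlen) as Hwalk.
  set (p := steps (gprod q) (t :: m)).
  assert (Hp : forall z, In z p -> ~ X z).
  { intros z Hz. apply in_steps in Hz. destruct Hz as [[|t' l1] [l2 [E [Hl1 ->]]]]; [easy|].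
    injection E as <- E. rewrite <- gprod_app. now apply (Havoid l1 l2). }
  assert (Hs : ginv s = gmul (gprod q) (gprod (t :: m))).
  { rewrite !gprod_app, gmulA in Hone. apply ginv_unique in Hone.
    rewrite <- (ginvK _ (gmul _ _)), <- Hone. simpl. now rewrite gmul1r. }
  assert (Ha : In (gmul (gprod q) t) p) by now left.
  assert (Hb : In (ginv s) p).
  { apply in_steps. exists (t :: m), []. now rewrite app_nil_r. }
  rewrite !Forall_app, Forall_cons_iff in Hgen. destruct Hgen as [_ [[Ht _] Hs']].
  assert (Hinfix : infix p (gone :: steps gone (q ++ (t :: m) ++ [s]))).
  { rewrite !steps_app, gmul1l. exists (gone :: steps gone q). eexists. reflexivity. }
  apply rt_step. refine (segment_conn_edge _ _ _ _ _ gone _ _ _ _ _ Hwalk Hinfix Hp Ha Hb _ _).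
  - now left.
  - apply nbhd_gen; auto.
  - rewrite <- (gmul1l _ (ginv s)) in *. apply nbhd_gen; [now left| |now apply Hp].
    inversion Hs'; auto.
Qed.

(* A letter [(b, s)] stands for the edge [s], preceded by an [h]-edge iff [b]: a word of
   letters is a walk that leaves the coset of [X] it is in with each letter. *)
Definition opt_h (b : bool) : list Gm := if b then [h] else [].

Definition spell (w : list letter) : list Gm :=
  flat_map (fun c => opt_h (fst c) ++ [snd c]) w.

Definition val (w : list letter) : Gm := gprod (spell w).

Definition proper (w : list letter) : Prop :=
  Forall (fun c => Gen (snd c) /\ snd c <> h) w.

Lemma spell_app w1 w2 : spell (w1 ++ w2) = spell w1 ++ spell w2.
Proof. apply flat_map_app. Qed.

Lemma val_app w1 w2 : val (w1 ++ w2) = gmul (val w1) (val w2).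
Proof. unfold val. now rewrite spell_app, gprod_app. Qed.

Lemma val_cons b s w : val ((b, s) :: w) = gmul (gprod (opt_h b)) (gmul s (val w)).
Proof.
  unfold val, spell. simpl. now rewrite <- app_assoc, gprod_app.
Qed.

Lemma spell_concat_repeat w N : spell (concat (repeat w N)) = concat (repeat (spell w) N).
Proof. induction N as [|N IH]; simpl; [easy|]. now rewrite spell_app, IH. Qed.

Lemma spell_Gen w : proper w -> Forall Gen (spell w).
Proof.
  intros H. induction H as [|[b s] w [Hs _] _ IH]; [constructor|].
  simpl. rewrite <- app_assoc. destruct b; simpl; auto.
Qed.

Lemma spell_length w : length w <= length (spell w).
Proof. induction w as [|c w IH]; simpl; [lia|]. rewrite !length_app. simpl. lia. Qed.

Lemma opt_h_in_X b : X (gprod (opt_h b)).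
Proof. destruct b; [right; apply gmul1r|now left]. Qed.

Lemma letter_notin_X c : Gen (snd c) -> snd c <> h -> ~ X (val [c]).
Proof.
  destruct c as [b s]. simpl. intros Hs Hsh. rewrite val_cons, X_mull by apply opt_h_in_X.
  unfold val. simpl. rewrite gmul1r. intros [-> | ->]; easy.
Qed.

Lemma opt_h_prefix b l1 l2 : opt_h b = l1 ++ l2 -> X (gprod l1).
Proof.
  destruct b; simpl; intros E.
  - destruct l1 as [|x [|y l1]]; [now left| |discriminate E].
    injection E as <- _. right. apply gmul1r.
  - symmetry in E. apply app_eq_nil in E as [-> _]. now left.
Qed.

Lemma spell_prefix w b l1 l2 :
  spell w ++ opt_h b = l1 ++ l2 ->
  exists w1 w2 x, w = w1 ++ w2 /\ X x /\ gprod l1 = gmul (val w1) x.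
Proof.
  revert l1. induction w as [|[b' s] w IH]; intros l1 E; simpl in E.
  - exists [], [], (gprod l1). rewrite gmul1l. eauto using opt_h_prefix.
  - rewrite <- !app_assoc in E. apply app_eq_app in E.
    destruct E as [l [[E1 E2]|[-> E2]]]; [|destruct l as [|t l]].
    + exists [], ((b', s) :: w), (gprod l1). rewrite gmul1l. eauto using opt_h_prefix.
    + exists [], ((b', s) :: w), (gprod (opt_h b')). rewrite app_nil_r, gmul1l.
      auto using opt_h_in_X.
    + injection E2 as <- E2. destruct (IH l E2) as [w1 [w2 [x [-> [Hx Hl]]]]].
      exists ((b', s) :: w1), w2, x. split; [easy|]. split; [easy|].
      rewrite gprod_app, val_cons. simpl. rewrite Hl. now autorewrite with grp.
Qed.

(** * Irreducible returns to a coset *)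

Definition irreducible (w : list letter) : Prop :=
  forall u, infix u w -> u <> [] -> X (val u) -> u = w.

Lemma exists_irreducible_infix w :
  w <> [] -> X (val w) -> exists v, infix v w /\ v <> [] /\ X (val v) /\ irreducible v.
Proof.
  induction w as [w IH] using (well_founded_induction (well_founded_ltof _ (@length _))).
  intros Hw HX. destruct (classic (irreducible w)) as [Hirr|Hred].
  { exists w. auto using infix_refl. }
  assert (Hu : exists u, infix u w /\ u <> [] /\ X (val u) /\ u <> w).
  { apply NNPP. intros Hno. apply Hred. intros u Hinf Hne Hu. apply NNPP.
    intros Huw. apply Hno. now exists u. }
  destruct Hu as [u [Hinf [Hne [Hu Huw]]]].
  destruct (IH u) as [v [Hv H]]; auto.
  - unfold ltof. apply Nat.nle_gt. intros Hle. now apply Huw, infix_length_eq.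
  - exists v. split; [now apply infix_trans with u|easy].
Qed.

Lemma irreducible_toggle_head b b' s w : irreducible ((b, s) :: w) -> irreducible ((b', s) :: w).
Proof.
  intros Hirr u [a [e E]] Hne Hu. destruct a as [|c a].
  - destruct u as [|c u]; [easy|]. injection E as <- E. f_equal.
    rewrite val_cons, X_mull in Hu by apply opt_h_in_X.
    assert (H : (b, s) :: u = (b, s) :: w).
    { apply Hirr; [exists [], e; simpl; now rewrite E|easy|].
      rewrite val_cons. apply X_mull; [apply opt_h_in_X|easy]. }
    now injection H.
  - injection E as _ E. assert (H : u = (b, s) :: w).
    { apply Hirr; auto. exists ((b, s) :: a), e. simpl. now rewrite E. }
    apply (f_equal (@length _)) in E, H. rewrite !length_app in E. simpl in H. lia.
Qed.

Lemma val_rot w1 w2 : val (w1 ++ w2) = gone -> val (w2 ++ w1) = gone.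
Proof.
  rewrite !val_app. intros H. apply ginv_unique in H. rewrite H. apply gmulVl.
Qed.

(* A cyclic subword that is not a subword has a subword as its complement, and the values
   of the two are inverse to each other. *)
Lemma irreducible_rot w1 w2 :
  val (w1 ++ w2) = gone -> irreducible (w1 ++ w2) -> irreducible (w2 ++ w1).
Proof.
  intros Hone Hirr u [a [e E]] Hne Hu.
  assert (Hlen : forall v, infix v (w1 ++ w2) -> v <> [] -> X (val v) ->
            length v = length (w2 ++ w1)).
  { intros v Hv Hv0 HX. rewrite (Hirr v Hv Hv0 HX), !length_app. lia. }
  assert (Hpos : 0 < length u) by (destruct u; [easy|simpl; lia]).
  apply infix_length_eq; [now exists a, e|].
  apply app_eq_app in E. destruct E as [v [[-> E]|[-> ->]]].
  - apply app_eq_app in E. destruct E as [u2 [[-> ->]|[-> ->]]].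
    + destruct (classic (e ++ a = [])) as [Hnil|Hnil].
      { apply app_eq_nil in Hnil as [-> ->]. now rewrite app_nil_r. }
      assert (Hea : length (e ++ a) = length ((a ++ v) ++ u2 ++ e)).
      { apply Hlen; [exists u2, v; now rewrite <- !app_assoc|easy|].
        replace (val (e ++ a)) with (ginv (val (v ++ u2))); [now apply X_inv|].
        symmetry. apply ginv_unique. rewrite <- val_app, <- app_assoc.
        apply val_rot. now rewrite <- !app_assoc in *. }
      rewrite !length_app in *. lia.
    + rewrite (Hlen u); auto. exists (w1 ++ a), u2. now rewrite <- !app_assoc.
  - rewrite (Hlen u); auto. exists v, (e ++ w2). now rewrite <- !app_assoc.
Qed.

Lemma irreducible_closed_sim c w c' :
  proper (c :: w ++ [c']) -> irreducible (c :: w ++ [c']) ->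
  val (c :: w ++ [c']) = gone -> length (spell (c :: w ++ [c'])) <= r ->
  sim (val [c]) (ginv (snd c')).
Proof.
  intros Hproper Hirr Hone Hlen. apply spell_Gen in Hproper.
  destruct c as [b s], c' as [b' s'].
  assert (Hspell : spell ((b, s) :: w ++ [(b', s')]) =
                   opt_h b ++ (s :: (spell w ++ opt_h b')) ++ [s']).
  { simpl. rewrite spell_app. simpl. now rewrite app_nil_r, <- !app_assoc. }
  unfold val in Hone. rewrite Hspell in *.
  rewrite val_cons, gmul1r. eapply closed_word_sim; eauto using opt_h_in_X.
  intros l1 l2 E HX. destruct (spell_prefix _ _ _ _ E) as [w1 [w2 [x [-> [Hx Hl1]]]]].
  assert (H : (b, s) :: w1 = (b, s) :: (w1 ++ w2) ++ [(b', s')]).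
  { apply Hirr; [|easy|].
    - exists [], (w2 ++ [(b', s')]). simpl. now rewrite <- app_assoc.
    - rewrite <- (X_mulr _ x Hx), val_cons.
      rewrite gprod_app in HX. simpl in HX. rewrite Hl1 in HX.
      now rewrite <- !gmulA. }
  apply (f_equal (@length _)) in H. simpl in H. rewrite !length_app in H. simpl in H. lia.
Qed.

Lemma irreducible_closed_junction w c c' :
  proper w -> irreducible w -> val w = gone -> length (spell w) <= r ->
  infix [c; c'] w -> sim (ginv (snd c)) (val [c']).
Proof.
  intros Hproper Hirr Hone Hlen [a [e ->]].
  replace (a ++ [c; c'] ++ e) with ((a ++ [c]) ++ c' :: e) in * by now rewrite <- app_assoc.
  replace (length _) with (length (spell ((c' :: e) ++ a ++ [c]))) in Hlen
    by (rewrite !spell_app, !length_app; lia).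
  apply irreducible_rot in Hirr; [|easy]. apply val_rot in Hone.
  unfold proper in Hproper. rewrite Forall_app in Hproper. apply and_comm in Hproper.
  rewrite <- Forall_app in Hproper.
  apply sim_sym, (irreducible_closed_sim c' (e ++ a) c); now rewrite <- app_assoc.
Qed.

(* After the letter [c] the walk enters a coset, translated to [X], from [(snd c)^-1], and
   leaves it with the letter [c'] to [val [c']]; the last clause compares in the same way the
   two ends of the return at the coset [X] itself. *)
Definition uncrossed_return (v : list letter) : Prop :=
  X (val v) /\
  (forall c c', infix [c; c'] v -> sim (ginv (snd c)) (val [c'])) /\
  (forall c u c', v = c :: u ++ [c'] ->
     sim (gmul (ginv (val v)) (val [c])) (ginv (snd c'))).

Lemma opt_h_mul x b :
  X x -> exists b', gprod (opt_h b') = gmul x (gprod (opt_h b)) /\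
    (length (opt_h b') <= length (opt_h b) \/
     x <> gone /\ length (opt_h b') <= S (length (opt_h b))).
Proof.
  intros [-> | ->].
  - exists b. rewrite gmul1l. auto.
  - exists (negb b). destruct b; simpl; autorewrite with grp; split; auto.
    right. split; [|lia]. intros E. apply Gen_ne1. now rewrite <- E.
Qed.

(* Toggling the [h]-edge in front of the first letter turns the return into a closed word. *)
Lemma irreducible_uncrossed v :
  proper v -> v <> [] -> irreducible v -> X (val v) ->
  (val v = gone /\ length (spell v) <= r \/ length (spell v) < r) ->
  uncrossed_return v.
Proof.
  intros Hproper Hne Hirr HX Hlen. split; [easy|].
  destruct v as [|[b s] v]; [easy|].
  destruct (opt_h_mul _ b (X_inv _ HX)) as [b' [Hb' Hopt_len]].
  assert (Hone : val ((b', s) :: v) = gone).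
  { rewrite val_cons, Hb', <- gmulA, <- val_cons. apply gmulVl. }
  assert (Htoggled_proper : proper ((b', s) :: v)).
  { constructor; [exact (Forall_inv Hproper)|exact (Forall_inv_tail Hproper)]. }
  assert (Htoggled_len : length (spell ((b', s) :: v)) <= r).
  { simpl in *. rewrite !length_app in *.
    destruct Hlen as [[Hv Hlen]|Hlen]; [|lia].
    destruct Hopt_len as [Hopt_len|[Hv' _]]; [lia|]. rewrite Hv, ginv1 in Hv'. easy. }
  apply irreducible_toggle_head with (b' := b') in Hirr. split.
  - intros c c' [[|c0 a] [e E]]; injection E; intros.
    + subst c v. apply (irreducible_closed_junction ((b', s) :: c' :: e) (b', s)); auto.
      now exists [], e.
    + apply (irreducible_closed_junction ((b', s) :: v)); auto.
      exists ((b', s) :: a), e. simpl. now f_equal.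
  - intros c u c' E. injection E as <- ->.
    replace (gmul _ _) with (val [(b', s)]); [now apply irreducible_closed_sim with u|].
    rewrite (val_cons b' s []), (val_cons b s []), Hb'. now autorewrite with grp.
Qed.

Lemma uncrossed_return_length v : proper v -> v <> [] -> uncrossed_return v -> 2 <= length v.
Proof.
  intros Hproper Hne [HX _]. destruct v as [|c [|c' v]]; simpl; [easy| |lia].
  apply Forall_inv in Hproper. now apply letter_notin_X in HX.
Qed.

Lemma periodic_word_return c l c' N :
  let L := c :: l ++ [c'] in
  proper L -> 0 < N -> gpow (val L) N = gone -> N * length (spell L) <= r ->
  ~ sim (ginv (snd c')) (val [c]) ->
  exists v, infix v L /\ 2 <= length v /\ uncrossed_return v.
Proof.
  intros L Hproper HN Hone Hlen Hcross. set (W := concat (repeat L N)).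
  assert (HW : val W = gone).
  { unfold val, W. now rewrite spell_concat_repeat, gprod_concat_repeat. }
  assert (HWlen : length (spell W) <= r).
  { unfold W. now rewrite spell_concat_repeat, length_concat_repeat. }
  assert (HWproper : proper W).
  { apply Forall_concat, Forall_forall. intros x Hx. now apply repeat_spec in Hx as ->. }
  destruct (exists_irreducible_infix W) as [v [Hinf [Hne [HX Hirr]]]].
  { unfold W. now destruct N. }
  { now left. }
  assert (Hvproper : proper v) by now apply Forall_infix with W.
  assert (Hv : uncrossed_return v).
  { apply irreducible_uncrossed; auto. destruct Hinf as [a [e E]].
    pose proof (f_equal (fun w => length (spell w)) E) as Elen. simpl in Elen.
    rewrite !spell_app, !length_app in Elen.
    pose proof (spell_length a). pose proof (spell_length e).
    destruct a, e; simpl in *; [left|right; lia..].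
    rewrite app_nil_r in E. rewrite <- E. auto. }
  exists v. split; [|split; [now apply uncrossed_return_length|easy]].
  apply infix_concat_repeat in Hinf. destruct Hinf as [Hinf|Hinf]; [easy|].
  now apply Hv in Hinf.
Qed.

(** * Similar generators *)

Variable N : nat.
Hypothesis N_pos : 0 < N.
Hypothesis N_r : 8 * N <= r.
Hypothesis conj_mul_pow :
  forall a b, gpow (gmul (gconj a h) (gconj b h)) N = gone.

Lemma ginv_ne_h s : s <> h -> ginv s <> h.
Proof. intros H E. apply H. now rewrite <- (ginvK _ s), E, ginv_involution. Qed.

Tactic Notation "val_norm" :=
  cbv [val spell flat_map opt_h app fst snd gprod fold_right gconj]; autorewrite with grp.
Tactic Notation "val_norm" "in" hyp(H) :=
  cbv [val spell flat_map opt_h app fst snd gprod fold_right gconj] in H;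
  autorewrite with grp in H.

Ltac solve_proper :=
  repeat constructor; simpl; auto using ginv_ne_h.

Lemma sim_hmul s : Gen s -> s <> h -> sim s (gmul h s).
Proof.
  intros Hs Hsh. apply NNPP. intros Hns.
  destruct (periodic_word_return (true, s) [] (true, ginv s) N)
    as [v [Hinf [Hlen [HX [_ Hends]]]]]; auto.
  - solve_proper.
  - rewrite <- (conj_mul_pow gone s). f_equal. now val_norm.
  - simpl. lia.
  - now val_norm.
  - apply infix_length_eq in Hinf; [|easy]. subst v.
    specialize (Hends (true, s) [] (true, ginv s) eq_refl).
    assert (Hval : val ((true, s) :: [] ++ [(true, ginv s)]) = gmul h (gconj s h))
      by now val_norm.
    rewrite Hval in HX, Hends. rewrite X_mull in HX by now right.
    apply gconj_in_X, gconj_commutes in HX. rewrite HX in Hends.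
    val_norm in Hends. now apply Hns, sim_sym.
Qed.

Lemma uncrossed_return_ends c u c' :
  proper (c :: u ++ [c']) -> uncrossed_return (c :: u ++ [c']) ->
  sim (snd c) (ginv (snd c')).
Proof.
  intros Hproper [HX [_ Hends]]. specialize (Hends c u c' eq_refl).
  apply Forall_inv in Hproper. destruct Hproper as [Hc Hch].
  eapply rt_trans; [|exact Hends]. apply X_inv in HX.
  destruct HX as [-> | ->]; destruct c as [[] s]; simpl in *; val_norm;
    try apply rt_refl; now apply sim_hmul.
Qed.

(* The word below spells [(t^-1 h t) (t h t^-1)]; if [t] and [t^-1] are not similar, a return
   can cross none of the junctions between the two factors, so it is one of them. *)
Lemma noncommuting_sim_inv t : Gen t -> ~ commutes h t -> sim t (ginv t).
Proof.
  intros Ht Hc. apply NNPP. intros Hns.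
  assert (Hth : t <> h) by (intros ->; now apply Hc).
  destruct (periodic_word_return (false, ginv t) [(true, t); (false, t)] (true, ginv t) N)
    as [v [Hinf [Hlen [HX [Hjunction _]]]]]; auto.
  - solve_proper.
  - rewrite <- (conj_mul_pow (ginv t) t). f_equal. now val_norm.
  - simpl. lia.
  - now val_norm.
  - apply (infix_split _ _ [(false, ginv t)] (true, t) (false, t) [(true, ginv t)]) in Hinf.
    destruct Hinf as [Hinf|[Hinf|Hinf]].
    + apply infix_length_eq in Hinf; [|easy]. subst v.
      val_norm in HX. apply Hc, gconj_inv_in_X. now val_norm.
    + apply infix_length_eq in Hinf; [|easy]. subst v.
      val_norm in HX. apply Hc, gconj_in_X. now val_norm.
    + apply Hjunction in Hinf. val_norm in Hinf. now apply Hns, sim_sym.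
Qed.

Lemma noncommuting_sim_of_inv t u :
  Gen t -> ~ commutes h t -> sim u (ginv t) -> sim u t.
Proof.
  intros Ht Hc H. apply rt_trans with (ginv t); [easy|].
  now apply sim_sym, noncommuting_sim_inv.
Qed.

Lemma conj_word_return_sim t u v :
  Gen t -> ~ commutes h t -> Gen u -> u <> h ->
  infix v [(false, u); (false, ginv t); (true, t); (false, ginv u)] ->
  2 <= length v -> uncrossed_return v -> sim u t.
Proof.
  intros Ht Hc Hu Huh Hinf Hlen Hv.
  assert (Hth : t <> h) by (intros ->; now apply Hc).
  assert (Hutt : sim u (ginv t) -> sim u t) by now apply noncommuting_sim_of_inv.
  assert (Hproper : proper v) by (eapply Forall_infix; [exact Hinf|solve_proper]).
  (* An end [t] or [t^-1] together with an end [u] or [u^-1] yields the similarity, which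
     leaves the return [t^-1 h t] and the whole word. *)
  destruct Hinf as [a [e E]].
  pose proof (f_equal (@length _) E) as Elen. rewrite !length_app in Elen.
  destruct a as [|? [|? [|? a]]], v as [|? [|? [|? [|? [|? v]]]]];
    simpl in Hlen, Elen; try lia; injection E; intros; subst; clear E Elen.
  - apply (uncrossed_return_ends _ []) in Hv; [|easy]. simpl in Hv. now rewrite ginvK in Hv.
  - apply (uncrossed_return_ends _ [_]) in Hv; [|easy]. now apply Hutt.
  - destruct Hv as [HX [Hjunction _]].
    assert (Hut : sim (ginv u) (ginv t)).
    { specialize (Hjunction (false, u) (false, ginv t)). val_norm in Hjunction.
      apply Hjunction. exists [], [(true, t); (false, ginv u)]. easy. }
    destruct (classic (commutes h u)) as [Hcu|Hcu].
    + destruct Hc. rewrite <- (ginvK _ t). apply commutes_invr.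
      rewrite <- (gmulKl _ u (ginv t)). apply commutes_mulr; [now apply commutes_invr|].
      apply gconj_in_X. val_norm in HX. now val_norm.
    + apply Hutt, rt_trans with (ginv u); [now apply noncommuting_sim_inv|easy].
  - destruct Hv as [HX _]. val_norm in HX.
    destruct Hc. apply gconj_inv_in_X. now val_norm.
  - apply (uncrossed_return_ends _ [_]) in Hv; [|easy]. simpl in Hv. rewrite ginvK in Hv.
    now apply Hutt, sim_sym.
  - apply (uncrossed_return_ends _ []) in Hv; [|easy]. simpl in Hv. rewrite ginvK in Hv.
    now apply sim_sym.
Qed.

(* The word below spells [(t^-1 h t) (u t^-1 h t u^-1)], and again a return lies within one of
   the two factors. *)
Lemma noncommuting_sim t u :
  Gen t -> ~ commutes h t -> Gen u -> u <> h -> sim u t.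
Proof.
  intros Ht Hc Hu Huh. apply NNPP. intros Hns.
  assert (Hth : t <> h) by (intros ->; now apply Hc).
  assert (Hns' : ~ sim u (ginv t)).
  { intros H. now apply Hns, noncommuting_sim_of_inv. }
  destruct (periodic_word_return (false, ginv t)
              [(true, t); (false, u); (false, ginv t); (true, t)] (false, ginv u) N)
    as [v [Hinf [Hlen Hv]]]; auto.
  - solve_proper.
  - rewrite <- (conj_mul_pow (ginv t) (gmul u (ginv t))). f_equal. now val_norm.
  - simpl. lia.
  - now val_norm.
  - apply (infix_split _ _ [(false, ginv t)] (true, t) (false, u)
             [(false, ginv t); (true, t); (false, ginv u)]) in Hinf.
    destruct Hinf as [Hinf|[Hinf|Hinf]].
    + apply infix_length_eq in Hinf; [|easy]. subst v. destruct Hv as [HX _].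
      val_norm in HX. apply Hc, gconj_inv_in_X. now val_norm.
    + now apply Hns, (conj_word_return_sim t u v).
    + apply Hv in Hinf. val_norm in Hinf. now apply Hns', sim_sym.
Qed.

Lemma nbhd_sim_gen a :
  nbhd Gm (cay_adj Gen) gone h a -> exists s, Gen s /\ s <> h /\ sim a s.
Proof.
  intros [Ha [x [Hx [s [Hs ->]]]]]. exists s.
  assert (Hsh : s <> h) by (intros ->; apply Ha, X_mul; [easy|now right]).
  do 2 (split; [easy|]). destruct Hx as [-> | ->].
  - rewrite gmul1l. apply rt_refl.
  - now apply sim_sym, sim_hmul.
Qed.

Lemma separator_commutes a b s :
  nbhd Gm (cay_adj Gen) gone h a -> nbhd Gm (cay_adj Gen) gone h b -> ~ sim a b ->
  Gen s -> commutes h s.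
Proof.
  intros Ha Hb Hab Hs. apply NNPP. intros Hc. apply Hab.
  destruct (nbhd_sim_gen a Ha) as [u [Hu [Huh Hau]]].
  destruct (nbhd_sim_gen b Hb) as [v [Hv [Hvh Hbv]]].
  apply rt_trans with s.
  - apply rt_trans with u; [easy|now apply noncommuting_sim].
  - apply sim_sym, rt_trans with v; [easy|now apply noncommuting_sim].
Qed.

End PairWords.

Theorem theorem6p3 (Gm : group) (n : nat) (S : Gm -> Prop) (r : nat) (h : Gm) :
  1 <= n ->
  nilpotent_le Gm n ->
  generating_set S ->
  ~ S gone ->
  2 ^ (n + 2) <= r -> 10 <= r ->
  S h ->
  local_2_separator Gm (cay_adj S) r gone h ->
  (forall v : Gm, ~ local_cutvertex Gm (cay_adj S) r v) ->
  involution h ->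
  normal (generated (fun x : Gm => x = h)).
Proof.
  intros Hn Hnil [Sinv Sgen] S1 Hr _ Sh [[a [b [Ha [Hb Hab]]]] _] _ [hh _].
  assert (HS : forall s, S s -> commutes h s).
  { intros s. apply (separator_commutes Gm S r h) with (N := 2 ^ (n - 1)) (a := a) (b := b); auto.
    - pose proof (Nat.pow_nonzero 2 (n - 1)). lia.
    - replace (n + 2) with (3 + (n - 1)) in Hr by lia. now rewrite Nat.pow_add_r in Hr.
    - intros c d. now apply nilpotent_conj_mul_pow. }
  intros g x Hx.
  assert (Hxg : commutes x g).
  { apply eq_sym, (generated_commutes (fun y => y = h)); [|easy].
    intros y ->. now apply eq_sym, (generated_commutes S). }
  apply gconj_commutes in Hxg. unfold gconj in Hxg. now rewrite Hxg.
Qed.
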